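(* For a positive integer $n$, let $A(n)$ denote the number of partitions of $n$ into distinct parts with a gap of at least $2$ between consecutive parts, and let $B(n)$ denote the number of partitions of $n$ into parts $\equiv 1,4 \pmod 5$. Let $C(n)$ denote the number of partitions of $n$ into distinct parts, such that if $o_j$ is the $j$-th odd part (where the odd parts are ordered in ascending order), then the even parts $o_j+2j-3$ and $o_j+2j-1$ do not appear. Let $D(n)$ denote the number of partitions of $n$ into distinct parts, such that if $e_j$ is the $j$-th even part (where the even parts are ordered in ascending order), then the odd parts $e_j+2j-3$ and $e_j+2j-1$ do not appear. Then $A(n)=B(n)=C(n)=D(n)$ for every positive integer $n$.
   Context: The condition in $C(n)$ is imposed for every $j$ from $1$ to the number of odd parts, with $o_1<o_2<\cdots$ all the odd parts of the partition; the condition in $D(n)$ is imposed for every $j$ from $1$ to the number of even parts, with $e_1<e_2<\cdots$ all the even parts. Parts of a partition are positive integers (so the requirement that ''the part $0$'' does not appear is vacuous). ''Gap of at least $2$ between consecutive parts'' means consecutive parts (in size order) differ by at least $2$. *)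

(* Defs.v *)
From mathcomp Require Import all_boot.

Set Implicit Arguments.
Unset Strict Implicit.
Unset Printing Implicit Defensive.

(* Partitions are listed in ascending order, so that the j-th odd (or even)
   part is directly the j-th item of the filtered list. *)
Definition is_partition (n : nat) (p : seq nat) : bool :=
  [&& sorted leq p, 0 \notin p & sumn p == n].

(* A partition of n has at most n parts, each of them at most n; it is therefore
   the list of values of a unique element of the finite type n.-bseq 'I_n.+1
   (lemmas parts_bseq_inj and is_partition_bseq below). *)
Definition parts (n : nat) (p : n.-bseq 'I_n.+1) : seq nat := map val p.

Definition num_partitions (n : nat) (P : pred (seq nat)) : nat :=
  #|[set p : n.-bseq 'I_n.+1 | is_partition n (parts p) && P (parts p)]|.

Lemma parts_bseq_inj (n : nat) : injective (@parts n).
Proof. by move=> p q /(inj_map val_inj) /val_inj. Qed.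

Lemma is_partition_bseq (n : nat) (s : seq nat) :
  is_partition n s -> exists p : n.-bseq 'I_n.+1, parts p = s.
Proof.
case/and3P=> _ s0 /eqP sn.
have size_s : size s <= n.
  rewrite -{}sn; elim: s s0 => //= x s IHs.
  rewrite inE negb_or eq_sym -lt0n => /andP[x_gt0 s0].
  by rewrite -add1n leq_add ?IHs.
have le_s x : x \in s -> x < n.+1.
  rewrite ltnS -{}sn; elim: s {s0 size_s} => //= y s IHs.
  rewrite inE => /predU1P[-> | /IHs le_x]; first exact: leq_addr.
  exact: leq_trans le_x (leq_addl _ _).
have sz : size (map (@inord n) s) <= n by rewrite size_map.
exists (Bseq sz); rewrite /parts /= -map_comp -[RHS]map_id.
by apply/eq_in_map=> x /le_s xn /=; rewrite inordK.
Qed.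

Definition gap2 (p : seq nat) : bool := sorted (fun x y => x + 2 <= y) p.

Definition parts_1_4_mod_5 (p : seq nat) : bool :=
  all (fun x => (x == 1 %[mod 5]) || (x == 4 %[mod 5])) p.

(* In the two predicates below the j-th item of the list is nth 0 _ j.-1, and
   the subtractions are never truncated: j >= 1 and the part is at least 1, so
   the part plus 2 * j is at least 3. *)
Definition odd_parts_condition (p : seq nat) : bool :=
  let o := [seq x <- p | odd x] in
  all (fun j => (nth 0 o j.-1 + 2 * j - 3 \notin p)
             && (nth 0 o j.-1 + 2 * j - 1 \notin p)) (iota 1 (size o)).

Definition even_parts_condition (p : seq nat) : bool :=
  let e := [seq x <- p | ~~ odd x] in
  all (fun j => (nth 0 e j.-1 + 2 * j - 3 \notin p)
             && (nth 0 e j.-1 + 2 * j - 1 \notin p)) (iota 1 (size e)).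

Definition A (n : nat) : nat :=
  num_partitions n (fun p => uniq p && gap2 p).

Definition B (n : nat) : nat := num_partitions n parts_1_4_mod_5.

Definition C (n : nat) : nat :=
  num_partitions n (fun p => uniq p && odd_parts_condition p).

Definition D (n : nat) : nat :=
  num_partitions n (fun p => uniq p && even_parts_condition p).

(* Main.v *)
(* The generating functions are evaluated in a commutative ring with an element
   [q] such that [q ^+ N = 0] (in the end [int[X] / X^(n+1)]), where every
   [1 - q ^+ i.+1] is invertible and all sums and products are finite.

   The partitions counted by A(n) that have [m] parts have generating function
   [q ^ (m^2) / (q; q)_m].  Summing over [m] and applying Bailey's lemma twice to
   the unit Bailey pair gives a theta series divided by [(q; q)_oo], which the
   Jacobi triple product turns into the product for B(n).

   For D(n), view an odd part as a tile of length 1 on the line of odd numbers,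
   and the j-th even part [e_j] as a tile of length 2 covering the two odd numbers
   it excludes.  Removing the first tile, or shifting all of them, gives a
   recurrence for the partitions with [r] even and [k] odd parts, [m = r + k],
   whose solution is [q ^ (m^2 + r) [m choose r]_(q^2) / (q^2; q^2)_m]; and Gauss's
   identity [sum_r q^r [m choose r]_(q^2) = (1 + q) ... (1 + q^m)] shows that
   summing over [r] gives [q ^ (m^2) / (q; q)_m] again.  C(n) reduces to D(n) by
   lowering the parts, after deletion of the part 1 if there is one. *)

Require Import Defs.
From mathcomp Require Import all_boot all_algebra ring zify.

Set Implicit Arguments.
Unset Strict Implicit.
Unset Printing Implicit Defensive.

Import GRing.Theory.

Local Open Scope ring_scope.

(** * Gaussian binomials and Bailey's lemma *)

Section QBinomial.
Variables (R : comNzRingType) (q : R).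
Implicit Types (x u v : R).

(** Gaussian binomials through the q-Pascal rule, since quotients of q-factorials make no sense in
    an arbitrary ring. *)
Fixpoint qbin (n k : nat) : R :=
  match n, k with
  | _, 0 => 1
  | 0, _.+1 => 0
  | n'.+1, k'.+1 => qbin n' k' + q ^+ k * qbin n' k
  end.

(** The q-Pochhammer symbol $(x; q)_n$. *)
Definition qpoch x (n : nat) : R := \prod_(i < n) (1 - x * q ^+ i).

Lemma qpochS x n : qpoch x n.+1 = qpoch x n * (1 - x * q ^+ n).
Proof. by rewrite /qpoch big_ord_recr. Qed.

Lemma qpochSl x n : qpoch x n.+1 = (1 - x) * qpoch (x * q) n.
Proof.
rewrite /qpoch big_ord_recl expr0 mulr1; congr (_ * _).
by apply: eq_bigr => i _; rewrite exprS mulrA.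
Qed.

Lemma qpochD x m n : qpoch x (m + n) = qpoch x m * qpoch (x * q ^+ m) n.
Proof.
rewrite /qpoch big_split_ord; congr (_ * _).
by apply: eq_bigr => i _; rewrite exprD mulrA.
Qed.

Lemma qbin0 n : qbin n 0 = 1. Proof. by case: n. Qed.

Lemma qbinS n k : qbin n.+1 k.+1 = qbin n k + q ^+ k.+1 * qbin n k.+1.
Proof. by []. Qed.

Lemma qbin_small n k : (n < k)%N -> qbin n k = 0.
Proof.
by elim: n k => [|n IH] [|k] //= lt_nk; rewrite !IH ?mulr0 ?addr0 // ltnW.
Qed.

Lemma qbinn n : qbin n n = 1.
Proof. by elim: n => //= n ->; rewrite qbin_small // mulr0 addr0. Qed.

Lemma qbinSr n k : (k <= n)%N ->
  qbin n.+1 k.+1 = q ^+ (n - k) * qbin n k + qbin n k.+1.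
Proof.
elim: n k => [|n IH] [|k] le_kn //; first by rewrite /= expr0; ring.
  rewrite qbinS {1}IH // !qbinS !qbin0 !subn0 !exprS expr0; ring.
have [->|lt_kn] := eqVneq k n.
  by rewrite subnn !qbinn qbin_small //; ring.
have {le_kn}lt_kn : (k < n)%N by lia.
have E1 := IH k (ltnW lt_kn); have E2 := IH k.+1 lt_kn.
rewrite qbinS {1}E1 {1}E2 !qbinS subSS -(subnSK lt_kn) !exprS; ring.
Qed.

Lemma qbin_sym n k : (k <= n)%N -> qbin n (n - k) = qbin n k.
Proof.
elim: n k => [|n IH] [|k] le_kn //; first by rewrite subn0 qbinn.
rewrite subSS; have [->|lt_kn] := eqVneq k n.
  by rewrite subnn qbinn.
have {le_kn}lt_kn : (k < n)%N by lia.
rewrite -{1}(subnSK lt_kn) qbinSr ?leq_subr // subnSK //.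
by rewrite (IH k.+1) // (IH k) 1?ltnW // subKn // qbinS addrC.
Qed.

Lemma qbin_poch a b :
  qbin (a + b) a * qpoch q a * qpoch q b = qpoch q (a + b).
Proof.
move En: (a + b)%N => n; elim: n a b En => [|n IH] [|a] [|b] // En.
- by rewrite /qpoch !big_ord0 /= !mulr1.
- by rewrite qbin0 /qpoch big_ord0 -En; ring.
- by rewrite -En addn0 qbinn /qpoch big_ord0; ring.
rewrite qbinS.
have {}IH1 := IH a b.+1 ltac:(lia); have {}IH2 := IH a.+1 b ltac:(lia).
transitivity (qpoch q n * (1 - q ^+ a.+1)
   + q ^+ a.+1 * (1 - q ^+ b.+1) * qpoch q n).
  by rewrite -{1}IH1 -IH2 !qpochS -!exprS; ring.
have -> : n = (a + b.+1)%N by lia.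
rewrite qpochS -!exprS !exprS exprD !exprS; ring.
Qed.

(** The q-Pascal rule under a sum: an induction on [n] becomes a termwise identity in which the
    terms of index [k] and [k.+1] combine. *)
Lemma sum_qbinS n (f : nat -> R) :
  \sum_(k < n.+2) qbin n.+1 k * f k =
  \sum_(k < n.+1) qbin n k * (q ^+ k * f k + f k.+1).
Proof.
rewrite big_ord_recl; under eq_bigr => i _ do rewrite lift0 qbinS mulrDl.
rewrite big_split /= addrCA.
under [RHS]eq_bigr => i _ do rewrite mulrDr.
rewrite big_split addrC /=; congr (_ + _).
rewrite [RHS]big_ord_recl !qbin0 expr0 !mul1r; congr (_ + _).
rewrite big_ord_recr /= qbin_small // mulr0 mul0r addr0.
by apply: eq_bigr => i _; rewrite /bump /= add1n; ring.
Qed.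

Lemma sum_qbinSr n (f : nat -> R) :
  \sum_(k < n.+2) qbin n.+1 k * f k =
  \sum_(k < n.+1) qbin n k * (f k + q ^+ (n - k) * f k.+1).
Proof.
rewrite big_ord_recl.
under eq_bigr => i _ do rewrite lift0 qbinSr -1?ltnS // mulrDl.
rewrite big_split /= addrCA.
under [RHS]eq_bigr => i _ do rewrite mulrDr.
rewrite big_split addrC /=; congr (_ + _); last first.
  by apply: eq_bigr => i _; ring.
rewrite [RHS]big_ord_recl !qbin0 !mul1r; congr (_ + _).
by rewrite big_ord_recr /= qbin_small // mul0r addr0.
Qed.

(** Cauchy's identity $\sum_i {n \brack i} x^i q^{i^2} / (xq; q)_i = 1 / (xq; q)_n$, cleared of
    denominators. By [sum_qbinS], consecutive terms for [n.+1] and [x] combine into one term for [n]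
    and [x * q]. *)
Lemma durfee_sum x n :
  \sum_(i < n.+1) qbin n i * (x ^+ i * q ^+ (i ^ 2) * qpoch (x * q ^+ i.+1) (n - i))
  = 1.
Proof.
elim: n x => [|n IH] x.
  by rewrite big_ord1 /= /qpoch big_ord0 !expr0; ring.
rewrite (sum_qbinS n (fun i => x ^+ i * q ^+ (i ^ 2)
  * qpoch (x * q ^+ i.+1) (n.+1 - i))).
rewrite -[RHS](IH (x * q)); apply: eq_bigr => -[i /= lt_in] _.
rewrite subSS subSn // qpochSl exprMn_comm; last exact: mulrC.
have -> : x * q * q ^+ i.+1 = x * q ^+ i.+2 by rewrite -mulrA -exprS.
have -> : x * q ^+ i.+1 * q = x * q ^+ i.+2 by rewrite -mulrA -exprSr.
have -> : (i.+1 ^ 2 = i ^ 2 + i + i + 1)%N by lia.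
rewrite !exprD !exprS; ring.
Qed.

(* [jacobi_term u v m j] is the coefficient of index [j - m] of the bilateral
   theta series with general term [v ^ r * q ^ (r (r - 1) / 2)], where [u]
   stands for [q / v]. *)
Definition jacobi_term u v (m j : nat) : R :=
  if (m <= j)%N then v ^+ (j - m) * q ^+ 'C(j - m, 2)
  else u ^+ (m - j) * q ^+ 'C(m - j, 2).

(** The finite Jacobi triple product. One q-Pascal rule adds the factors in [u] while [n = 0], the
    other then adds the factors in [v]. *)
Lemma finite_jacobi u v m n : u * v = q ->
  qpoch (- u) m * qpoch (- v) n =
  \sum_(j < (m + n).+1) qbin (m + n) j * jacobi_term u v m j.
Proof.
move=> uv; elim: n => [|n IH].
  rewrite addn0 {2}/qpoch big_ord0 mulr1.
  elim: m => [|m IH].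
    by rewrite /qpoch big_ord0 big_ord1 /jacobi_term /= !expr0; ring.
  rewrite sum_qbinS qpochS IH big_distrl /=.
  apply: eq_bigr => -[j /= le_jm] _; rewrite /jacobi_term ltnS subSS.
  have -> : (m < j)%N = false by lia.
  rewrite subSn // binS bin1 exprS exprD.
  case: leqP => le_mj.
    have -> : j = m by lia.
    by rewrite subnn /= !expr0; ring.
  have -> : q ^+ m = q ^+ j * q ^+ (m - j) by rewrite -exprD subnKC.
  ring.
rewrite addnS sum_qbinSr qpochS mulrA IH big_distrl /=.
apply: eq_bigr => -[j /= le_jm] _; rewrite -mulrA; congr (_ * _).
rewrite mulrDr mulr1; congr (_ + _).
rewrite /jacobi_term; case: leqP => le_mj.
  rewrite leqW // subSn // binS bin1 exprS exprD.
  have -> : q ^+ n = q ^+ (m + n - j) * q ^+ (j - m).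
    by rewrite -exprD; congr (_ ^+ _); lia.
  ring.
have [d Ed] : exists d, m = (j + d.+1)%N by exists (m - j.+1)%N; lia.
have -> : (m + n - j = n + d.+1)%N by lia.
have -> : (m - j = d.+1)%N by lia.
have Ejacobi : (if (m <= j.+1)%N then v ^+ (j.+1 - m) * q ^+ 'C(j.+1 - m, 2)
    else u ^+ (m - j.+1) * q ^+ 'C(m - j.+1, 2)) = u ^+ d * q ^+ 'C(d, 2).
  rewrite Ed; case: d {Ed} => [|d].
    by rewrite addn1 leqnn subnn.
  have -> : (j + d.+2 <= j.+1)%N = false by lia.
  by have -> : (j + d.+2 - j.+1 = d.+1)%N by lia.
rewrite {}Ejacobi binS bin1 exprD !exprD !exprS -uv; ring.
Qed.

(** Indices [r] and [-r] of the bilateral theta series taken together; index 0 is counted once. *)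
Definition theta_coef u v (r : nat) : R :=
  if r == 0%N then 1 else (u ^+ r + v ^+ r) * q ^+ 'C(r, 2).

Lemma finite_theta u v n : u * v = q ->
  qpoch (- u) n * qpoch (- v) n =
  \sum_(r < n.+1) theta_coef u v r * qbin (n + n) (n + r).
Proof.
move=> uv; rewrite finite_jacobi // -addnS big_split_ord /=.
rewrite [X in _ + X]big_ord_recl [RHS]big_ord_recl /= addn0 addrCA.
congr (_ + _); first by rewrite /jacobi_term /theta_coef leqnn subnn bin0n /= !expr0 !mulr1 mul1r.
(* Reversing the lower half of the range pairs the indices [n - r.+1] and [n + r.+1], where the
   Gaussian binomials agree by symmetry. *)
rewrite (reindex_inj rev_ord_inj) /= -big_split; apply: eq_bigr => -[r /= ltrn] _.
rewrite /bump /= add1n /theta_coef /jacobi_term /= leq_addr addKn.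
have -> : (n <= n - r.+1)%N = false by lia.
rewrite subKn // -[qbin _ (n - r.+1)]qbin_sym; last by lia.
have -> : (n + n - (n - r.+1) = n + r.+1)%N by lia.
ring.
Qed.

End QBinomial.

(** * Bailey's lemma, with [w n] in the role of $1 / (q; q)_n$ *)

Section Bailey.
Variables (R : comNzRingType) (q : R) (w : nat -> R).
Hypothesis w_poch : forall n, w n * qpoch q q n = 1.

Lemma qbinE a b : qbin q (a + b) a = qpoch q q (a + b) * w a * w b.
Proof.
rewrite -qbin_poch; set c := qbin _ _ _.
transitivity (c * (w a * qpoch q q a) * (w b * qpoch q q b)); last by ring.
by rewrite !w_poch !mulr1.
Qed.

Lemma sum_triangle (F : nat -> nat -> R) n :
  \sum_(i < n.+1) \sum_(j < i.+1) F i j =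
  \sum_(j < n.+1) \sum_(i < (n - j).+1) F (j + i)%N j.
Proof.
elim: n => [|n IH]; first by rewrite !big_ord1.
rewrite big_ord_recr /= IH [RHS]big_ord_recr /= subnn big_ord1 addn0.
rewrite [X in _ + X]big_ord_recr addrA; congr (_ + _).
rewrite -big_split; apply: eq_bigr => -[j /= lejn] _.
by rewrite subSn // [RHS]big_ord_recr /= -subSn // subnKC // leqW.
Qed.

(** Bailey's lemma for pairs relative to 1, in the limit where both free parameters go to infinity:
    [alpha r] is replaced by [q ^+ (r ^ 2) * alpha r]. After exchanging the sums, the inner one is
    [durfee_sum] at $x = q^{2r}$. *)
Lemma bailey (alpha : nat -> R) n :
  \sum_(k < n.+1) q ^+ (k ^ 2) * w (n - k) *
     \sum_(r < k.+1) alpha r * w (k - r) * w (k + r) =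
  \sum_(r < n.+1) q ^+ (r ^ 2) * alpha r * w (n - r) * w (n + r).
Proof.
under eq_bigr do rewrite big_distrr.
rewrite (sum_triangle (fun k r => q ^+ (k ^ 2) * w (n - k) *
   (alpha r * w (k - r) * w (k + r)))).
apply: eq_bigr => -[r /= lern] _.
have := durfee_sum q (q ^+ (r + r)) (n - r).
move/(congr1 (fun x => q ^+ (r ^ 2) * alpha r * w (n - r) * w (n + r) * x)).
rewrite mulr1 => <-; rewrite big_distrr; apply: eq_bigr => -[i /= lei] _.
have -> : (n - (r + i) = n - r - i)%N by lia.
rewrite addKn.
have := qbinE i (n - r - i); rewrite subnKC // => ->.
(* The remaining product is the quotient $(q; q)_{n+r} / (q; q)_{2r+i}$. *)
have : w (n + r)%N * qpoch q (q ^+ (r + r) * q ^+ i.+1) (n - r - i)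
   = w (r + i + r)%N.
  have En : (n + r = r + i + r + (n - r - i))%N by lia.
  have := w_poch (n + r); rewrite {2}En qpochD -exprS.
  have -> : (r + i + r).+1 = (r + r + i.+1)%N by lia.
  rewrite exprD => /(congr1 ( *%R (w (r + i + r)))); rewrite mulr1 => <-.
  by rewrite -[LHS]mul1r -{1}(w_poch (r + i + r)); ring.
set t := qpoch _ _ _ => <-.
have -> : q ^+ ((r + i) ^ 2) = q ^+ (r ^ 2) * q ^+ (r + r) ^+ i * q ^+ (i ^ 2).
  by rewrite -exprM -!exprD; congr (_ ^+ _); lia.
by rewrite -[LHS]mul1r -{1}(w_poch (n - r)); ring.
Qed.

End Bailey.

(** * The Rogers-Ramanujan identity modulo a power of [q] *)

Section Nilpotent.
Variables (R : comNzRingType) (N : nat).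
Implicit Types (q : R).

(** Geometric series cut after [N] terms; once [q ^+ N = 0], each one inverts its factor
    [1 - q ^+ i.+1]. *)
Definition qpoch_inv q n : R := \prod_(i < n) \sum_(j < N) (q ^+ i.+1) ^+ j.

Lemma nilpotent_order_gt0 q : q ^+ N = 0 -> (0 < N)%N.
Proof. by rewrite lt0n; case: eqP => // ->; move/eqP; rewrite oner_eq0. Qed.

Lemma nilpotent_geq q n : q ^+ N = 0 -> (N <= n)%N -> q ^+ n = 0.
Proof. by move=> qN leNn; rewrite -(subnK leNn) exprD qN mulr0. Qed.

Lemma qpoch_invK q n : q ^+ N = 0 -> qpoch_inv q n * qpoch q q n = 1.
Proof.
move=> qN; rewrite /qpoch_inv /qpoch -big_split big1 // => i _ /=.
rewrite mulrC -exprS -[1 - _]opprB mulNr -subrX1 -exprM mulnC exprM qN.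
by rewrite expr0n /= sub0r opprK.
Qed.

(** The factors from index [N] on are 1, so [N] plays the role of infinity and [qpoch q q N] that of
    $(q; q)_\infty$. *)
Lemma qpoch_stable q n : q ^+ N = 0 -> (N <= n)%N -> qpoch q q n = qpoch q q N.
Proof.
move=> qN leNn; rewrite -(subnKC leNn) qpochD -exprS exprS qN mulr0.
by rewrite /qpoch [X in _ * X]big1 ?mulr1 // => i _; rewrite mul0r subr0.
Qed.

Lemma qpoch_inv_stable q n :
  q ^+ N = 0 -> (N <= n)%N -> qpoch_inv q n = qpoch_inv q N.
Proof.
move=> qN leNn; rewrite -[LHS]mulr1 -(qpoch_invK N qN) mulrCA.
by rewrite -(qpoch_stable qN leNn) qpoch_invK // mulr1.
Qed.

Lemma sum_ord_trunc (F : nat -> R) m n : (m <= n)%N ->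
  (forall i, (m <= i)%N -> F i = 0) -> \sum_(i < n) F i = \sum_(i < m) F i.
Proof.
move=> lemn F0; rewrite -(subnKC lemn) big_split_ord /= [X in _ + X]big1 ?addr0 //.
by move=> i _; rewrite F0 ?leq_addr.
Qed.

End Nilpotent.

Lemma sqr_bin2 r : (r ^ 2 = r + 'C(r, 2) + 'C(r, 2))%N.
Proof. elim: r => // r IH; rewrite binS bin1; lia. Qed.

(** Sorts the exponents from 1 to [5 * n] by their residue modulo 5. *)
Lemma qpoch5 (R : comNzRingType) (q : R) n : qpoch q q (5 * n) =
  qpoch (q ^+ 5) q n * qpoch (q ^+ 5) (q ^+ 2) n * qpoch (q ^+ 5) (q ^+ 3) n
  * qpoch (q ^+ 5) (q ^+ 4) n * qpoch (q ^+ 5) (q ^+ 5) n.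
Proof.
elim: n => [|n IH]; first by rewrite muln0 /qpoch !big_ord0 !mulr1.
rewrite mulnS addnC qpochD IH !qpochS /qpoch big_ord0 -!exprM.
have -> : q ^+ (5 * n) = (q ^+ n) ^+ 5 by rewrite mulnC exprM.
ring.
Qed.

Section RogersRamanujan.
Variables (R : comNzRingType) (N : nat) (q : R).
Hypothesis qN : q ^+ N = 0.
Local Notation w := (qpoch_inv N q).
Let wK n : w n * qpoch q q n = 1. Proof. exact: qpoch_invK. Qed.

(** The unit Bailey pair: $\alpha_0 = 1$ and $\alpha_r = (-1)^r q^{r(r-1)/2} (1 + q^r)$ for $r >
    0$. *)
Let alpha (r : nat) := theta_coef q (- q) (- 1) r.

(** By [finite_theta] the sum is a multiple of $(1; q)_n$, which contains the factor $1 - 1$ as soon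
    as $n > 0$. *)
Lemma unit_bailey_pair n :
  \sum_(r < n.+1) alpha r * w (n - r) * w (n + r) = (n == 0%N)%:R.
Proof.
have th := @finite_theta _ q (- q) (- 1) n; move: th.
rewrite mulrNN mulr1 !opprK => /(_ erefl) th.
have -> : \sum_(r < n.+1) alpha r * w (n - r) * w (n + r)
    = w (n + n) * (qpoch q q n * qpoch q 1 n).
  rewrite th big_distrr /=; apply: eq_bigr => -[r /= ltr] _.
  have := qbinE wK (n + r) (n - r).
  rewrite (_ : (n + r + (n - r) = n + n)%N); last by lia.
  move=> ->; rewrite -[LHS]mul1r -{1}(wK (n + n)) /alpha; ring.
case: n {th} => [|n]; first by rewrite /qpoch_inv /qpoch !big_ord0 !mulr1.
by rewrite [qpoch q 1 _]qpochSl subrr mul0r !mulr0.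
Qed.

Lemma sum_delta (F : nat -> R) n : \sum_(k < n.+1) F k * (k == 0%N :> nat)%:R = F 0%N.
Proof.
by rewrite big_ord_recl big1 /= ?mulr1 ?addr0 // => i _; rewrite mulr0.
Qed.

Lemma iterated_bailey n :
  \sum_(k < n.+1) q ^+ (k ^ 2) * w (n - k) * w k =
  \sum_(r < n.+1) theta_coef (q ^+ 5) (- q ^+ 3) (- q ^+ 2) r
     * w (n - r) * w (n + r).
Proof.
have bailey1 k : w k =
    \sum_(r < k.+1) q ^+ (r ^ 2) * alpha r * w (k - r) * w (k + r).
  rewrite -(bailey wK); under eq_bigr do rewrite unit_bailey_pair.
  by rewrite (sum_delta (fun k' => q ^+ (k' ^ 2) * w (k - k'))) subn0 mul1r.
under eq_bigr => k _ do rewrite [w k]bailey1.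
rewrite (bailey wK (fun r => q ^+ (r ^ 2) * alpha r)).
apply: eq_bigr => -[r /= _] _; congr (_ * _ * _).
rewrite /alpha /theta_coef; case: eqP => [->|_]; first by rewrite !mul1r.
(* Two uses of Bailey's lemma contribute $q^{2r^2}$, and $2r^2 + {r \choose 2} = 2r + 5{r \choose
   2}$: this is a theta series in base $q^5$. *)
rewrite sqr_bin2 ![(- q ^+ _) ^+ r]exprNn [(- q) ^+ r]exprNn !exprD.
rewrite [(q ^+ 3) ^+ _]exprAC [(q ^+ 2) ^+ _]exprAC [(q ^+ 5) ^+ _]exprAC; ring.
Qed.

Lemma rogers_ramanujan :
  (\sum_(k < N) q ^+ (k ^ 2) * w k)
    * (qpoch (q ^+ 5) q (N + N) * qpoch (q ^+ 5) (q ^+ 4) (N + N)) = 1.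
Proof.
pose Q := q ^+ 5; pose theta := theta_coef Q (- q ^+ 3) (- q ^+ 2).
have QN : Q ^+ N = 0 by rewrite /Q -exprM mulnC exprM qN expr0n.
have leN2N : (N <= (N + N).+1)%N by lia.
have WK n := qpoch_invK n QN.
have theta0 r : (N <= r)%N -> theta r = 0.
  case: r => [|r] leNr; rewrite /theta /theta_coef /=.
    by rewrite -(expr0 q); apply: nilpotent_geq leNr.
  have q0 c : (q ^+ c.+1) ^+ r.+1 = 0.
    by rewrite -exprM; apply: nilpotent_geq qN _; nia.
  by rewrite ![(- q ^+ _) ^+ _]exprNn !q0 !mulr0 addr0 mul0r.
(* At [n = N + N] the surviving terms have index below [N], so [n - k] is still above [N] and every
   such [w] equals [w N]. Multiplying by [qpoch q q N] cancels one copy of it on each side. *)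
have sum_theta : \sum_(k < N) q ^+ (k ^ 2) * w k = w N * \sum_(r < N) theta r.
  have := iterated_bailey (N + N).
  rewrite (@sum_ord_trunc _ (fun k => q ^+ (k ^ 2) * w (N + N - k) * w k) _ _ leN2N);
    last by move=> i leNi; rewrite (nilpotent_geq qN) ?mul0r //; nia.
  rewrite (@sum_ord_trunc _ (fun r => theta r * w (N + N - r) * w (N + N + r)) _ _ leN2N);
    last by move=> i leNi; rewrite theta0 ?mul0r.
  move=> /(congr1 (fun x => qpoch q q N * x)).
  rewrite !big_distrr /= => E.
  transitivity (\sum_(i < N) qpoch q q N * (q ^+ (i ^ 2) * w (N + N - i) * w i)).
    apply: eq_bigr => -[k /= ltkN] _; rewrite (qpoch_inv_stable (n := _ - _) qN); last by lia.
    by rewrite -[LHS]mul1r -(wK N); ring.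
  rewrite E; apply: eq_bigr => -[k /= ltkN] _.
  rewrite !(qpoch_inv_stable (n := N + N - k) qN, qpoch_inv_stable (n := N + N + k) qN); try lia.
  by rewrite -[RHS]mul1r -(wK N); ring.
(* The triple product in base [Q]: at these sizes the Gaussian binomial is already $1 / (Q;
   Q)_\infty$. *)
have jacobi : qpoch Q (q ^+ 3) (N + N) * qpoch Q (q ^+ 2) (N + N)
    * qpoch Q Q (N + N) = \sum_(r < N) theta r.
  have := @finite_theta _ Q (- q ^+ 3) (- q ^+ 2) (N + N).
  rewrite !opprK => -> ; last by rewrite /Q; ring.
  rewrite (@sum_ord_trunc _ (fun r => theta r * qbin Q (N + N + (N + N)) (N + N + r))
    _ _ leN2N);
    last by move=> i leNi; rewrite theta0 ?mul0r.
  rewrite big_distrl /=; apply: eq_bigr => -[r /= ltrN] _.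
  have := qbinE WK (N + N + r) (N + N - r).
  rewrite (_ : (N + N + r + (N + N - r) = N + N + (N + N))%N); last by lia.
  move=> ->; rewrite !(qpoch_stable (n := N + N + (N + N)) QN, qpoch_stable (n := N + N) QN,
    qpoch_inv_stable (n := N + N - r) QN, qpoch_inv_stable (n := N + N + r) QN); try lia.
  have := WK N; set x := qpoch_inv _ _ _; set y := qpoch _ _ _ => xy.
  by rewrite -[RHS]mulr1 -{1}[RHS]mulr1 -{1}xy -xy; ring.
(* Of the five residue classes, 0, 2 and 3 form the theta series, which leaves 1 and 4. *)
have := wK (5 * (N + N)); rewrite qpoch5 -/Q (qpoch_inv_stable qN); last by lia.
rewrite sum_theta -jacobi => <-; ring.
Qed.

End RogersRamanujan.

(** * Generating functions of partitions *)

Definition positive_sorted (p : seq nat) := sorted leq p && (0%N \notin p).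

Definition partitions (n : nat) : seq (seq nat) :=
  [seq parts p | p <- enum [set p : n.-bseq 'I_n.+1 | is_partition n (parts p)]].

Lemma mem_partitions n p : (p \in partitions n) = is_partition n p.
Proof.
apply/mapP/idP => [[b]|pp]; first by rewrite mem_enum inE => ? ->.
have [b Eb] := is_partition_bseq pp.
by exists b; rewrite // mem_enum inE Eb.
Qed.

Lemma partitions_uniq n : uniq (partitions n).
Proof.
by rewrite map_inj_uniq ?enum_uniq //; apply: parts_bseq_inj.
Qed.

Lemma num_partitionsE n P : num_partitions n P = count P (partitions n).
Proof.
rewrite /num_partitions /partitions count_map -size_filter cardE.
apply/perm_size/uniq_perm; rewrite ?enum_uniq 1?filter_uniq ?enum_uniq // => p.
by rewrite [RHS]mem_filter !mem_enum !inE andbC.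
Qed.

Lemma sum_ord_split (V : nmodType) (F : nat -> V) m n p : (m + n)%N = p ->
  \sum_(i < p) F i = \sum_(i < m) F i + \sum_(i < n) F (m + i)%N.
Proof. by move=> <-; rewrite big_split_ord. Qed.

Section GeneratingFunction.
Variables (R : comNzRingType) (N : nat) (q : R).
Hypothesis qN : q ^+ N = 0.

Definition gf (P : pred (seq nat)) : R :=
  \sum_(n < N) (num_partitions n P)%:R * q ^+ n.

Lemma is_partitionE n p : is_partition n p = positive_sorted p && (sumn p == n).
Proof. by rewrite /is_partition andbA. Qed.

Lemma eq_gf (P Q : pred (seq nat)) : (forall p, positive_sorted p -> P p = Q p) -> gf P = gf Q.
Proof.
move=> PQ; apply: eq_bigr => n _; rewrite !num_partitionsE.
congr (_%:R * _); apply: eq_in_count => p.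
by rewrite mem_partitions is_partitionE => /andP[/PQ].
Qed.

Lemma gf_split (Q P : pred (seq nat)) :
  gf P = gf (fun p => P p && Q p) + gf (fun p => P p && ~~ Q p).
Proof.
rewrite -big_split; apply: eq_bigr => n _ /=; rewrite -mulrDl -natrD.
rewrite !num_partitionsE; congr (_%:R * _).
by elim: (partitions n) => //= p s ->; case: (P p); case: (Q p) => //=; lia.
Qed.

Lemma gf_sum (h : seq nat -> nat) M (P : pred (seq nat)) :
  (forall p, positive_sorted p -> (sumn p < N)%N -> P p -> (h p < M)%N) ->
  gf P = \sum_(m < M) gf (fun p => P p && (h p == m)).
Proof.
move=> hM; rewrite exchange_big; apply: eq_bigr => n _ /=.
rewrite -big_distrl -natr_sum /=; congr (_%:R * _).
rewrite num_partitionsE; under eq_bigr do rewrite num_partitionsE.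
have: {in partitions n, forall p, P p -> (h p < M)%N}.
  move=> p; rewrite mem_partitions is_partitionE => /andP[pp /eqP Ep].
  by apply: hM => //; rewrite Ep.
elim: (partitions n) => [|p s IH] sP /=; first by rewrite big1.
rewrite IH => [|p' sp']; last by apply: sP; rewrite inE sp' orbT.
rewrite big_split /=; congr (_ + _)%N.
case Pp: (P p) => /=; last by rewrite big1.
rewrite (bigD1 (Ordinal (sP _ (mem_head _ _) Pp))) //= eqxx big1 // => i.
by rewrite -val_eqE /= eq_sym => /negPf->.
Qed.

Lemma gf_unit (P : pred (seq nat)) : (0 < N)%N -> P [::] ->
  (forall p, positive_sorted p -> (sumn p < N)%N -> P p -> p = [::]) -> gf P = 1.
Proof.
rewrite /gf; case: N => // M _ Pnil P0; rewrite big_ord_recl big1 => [|i _].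
  rewrite num_partitionsE expr0 mulr1 addr0.
  have -> : partitions 0 = [:: [::]].
    apply: perm_small_eq => //; apply: uniq_perm; rewrite ?partitions_uniq // => p.
    rewrite mem_partitions is_partitionE inE; apply/idP/eqP => [|->//].
    by case: p => // x p /andP[/andP[_]]; rewrite inE /=; case: x.
  by rewrite /= Pnil.
rewrite num_partitionsE lift0 (eq_in_count (a2 := pred0)) ?count_pred0 ?mul0r //.
move=> p; rewrite mem_partitions is_partitionE => /andP[pp /eqP Ep] /=.
apply/negP => /(P0 p pp); rewrite Ep ltnS ltn_ord => /(_ isT) pE.
by rewrite pE in Ep.
Qed.

(** Turns each bijection below into an equation of generating functions. The top [d] coefficients of
    [gf P] are pushed to degree [N] or more, where [q ^+ N = 0] kills them. *)
Lemma gf_shift d (f : seq nat -> seq nat) (P Q : pred (seq nat)) :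
    (forall p, P p -> positive_sorted p) -> (forall p, Q p -> positive_sorted p) ->
    (forall p, P p -> Q (f p) /\ sumn (f p) = (sumn p + d)%N) ->
    (forall p, Q p -> exists2 p0, P p0 & f p0 = p) ->
    {in P &, injective f} ->
  gf Q = q ^+ d * gf P.
Proof.
move=> Ppart Qpart fP fQ f_inj.
have num_shift n : num_partitions (n + d) Q = num_partitions n P.
  rewrite !num_partitionsE -!size_filter -[RHS](size_map f).
  apply/perm_size/uniq_perm; rewrite ?filter_uniq ?partitions_uniq //.
    rewrite map_inj_in_uniq ?filter_uniq ?partitions_uniq // => x y.
    by rewrite !mem_filter => /andP[Px _] /andP[Py _]; exact: (f_inj x y Px Py).
  move=> p; rewrite mem_filter mem_partitions is_partitionE.
  apply/idP/mapP => [/and3P[Qp pp Ep]|[p0]].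
    have [p0 Pp0 Ep0] := fQ p Qp; exists p0 => //.
    rewrite mem_filter mem_partitions is_partitionE Pp0 Ppart //=.
    by have [_] := fP p0 Pp0; rewrite Ep0 (eqP Ep) => /addIn->.
  rewrite mem_filter mem_partitions is_partitionE => /and3P[Pp0 pp0 /eqP Ep0] ->.
  by have [Qp ->] := fP p0 Pp0; rewrite Qp Qpart // Ep0 eqxx.
have num_small n : (n < d)%N -> num_partitions n Q = 0%N.
  move=> ltnd; rewrite num_partitionsE; apply/eqP; rewrite -leqn0 leqNgt -has_count.
  apply/hasP => -[p]; rewrite mem_partitions is_partitionE => /andP[_ /eqP Ep].
  move=> /fQ [p0 Pp0 Ep0]; have [_] := fP p0 Pp0; rewrite Ep0; lia.
have [leNd|ltdN] := leqP N d.
  rewrite -(subnK leNd) exprD qN mulr0 mul0r.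
  by rewrite /gf big1 // => n _; rewrite num_small ?mul0r // (leq_trans _ leNd).
have -> : gf P = \sum_(n < N - d) (num_partitions n P)%:R * q ^+ n
    + \sum_(n < d) (num_partitions (N - d + n) P)%:R * q ^+ (N - d + n).
  exact: (sum_ord_split (fun n => (num_partitions n P)%:R * q ^+ n) (subnK (ltnW ltdN))).
rewrite mulrDr [X in _ + X]big_distrr [X in _ + X]big1 ?addr0 => [|n _] /=; last first.
  rewrite mulrCA -exprD (_ : (d + (N - d + n) = N + n)%N); last by lia.
  by rewrite exprD qN mul0r mulr0.
rewrite /gf (sum_ord_split (fun n => (num_partitions n Q)%:R * q ^+ n)
  (subnKC (ltnW ltdN))) big1 => [|n _]; last first.
  by rewrite num_small ?mul0r.
rewrite add0r big_distrr; apply: eq_bigr => n _.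
by rewrite /= addnC num_shift exprD; ring.
Qed.

End GeneratingFunction.

(** * Tilings by odd and even parts *)

Local Open Scope nat_scope.

Definition strict (p : seq nat) := path ltn 0 p.

Lemma strictE p : strict p = positive_sorted p && uniq p.
Proof.
rewrite /strict /positive_sorted path_sortedE; last exact: ltn_trans.
rewrite ltn_sorted_uniq_leq [uniq p && _]andbC andbA [all _ _ && _]andbC.
congr (_ && _ && _); apply/allP/idP => [p_gt0|p0 x].
  by apply/negP => /p_gt0.
by case: x p0 => // /negPf->.
Qed.

Lemma strict_positive p : strict p -> positive_sorted p.
Proof. by rewrite strictE => /andP[]. Qed.

Lemma strict_sorted p : strict p -> sorted ltn p.
Proof. exact: path_sorted. Qed.

Lemma strict_gt0 p x : strict p -> x \in p -> (0 < x)%N.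
Proof. by move=> sp; apply: (allP (order_path_min ltn_trans sp)). Qed.

Lemma sorted_ltn_eq s t : sorted ltn s -> sorted ltn t -> s =i t -> s = t.
Proof. exact: (irr_sorted_eq ltn_trans ltnn). Qed.

Lemma sumn_shift s p : sumn (map (addn s) p) = (sumn p + s * size p)%N.
Proof. by elim: p => [|x p /= ->]; rewrite ?muln0 // mulnS; lia. Qed.

Lemma strict_shift s p : strict p -> path ltn s (map (addn s) p).
Proof.
move=> sp; rewrite -{1}(addn0 s) path_map.
by rewrite (eq_path (e' := ltn)) // => x y /=; rewrite ltn_add2l.
Qed.

Lemma path_shift_inv s p : path ltn s p ->
  exists2 p0, strict p0 & map (addn s) p0 = p.
Proof.
move=> sp; exists (map (subn^~ s) p); last first.
  rewrite -map_comp -[RHS]map_id; apply/eq_in_map => x xp /=.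
  by rewrite subnKC // ltnW // (allP (order_path_min ltn_trans sp)).
have: forall y, s <= y -> path ltn y p -> path ltn (y - s) (map (subn^~ s) p).
  elim: p {sp} => //= x p IH y lesy /andP[ltyx xp].
  by rewrite ltn_sub2rE // ltyx IH // (leq_trans lesy) // ltnW.
by move=> /(_ s (leqnn s) sp); rewrite subnn.
Qed.

Definition gap2_size (m : nat) (p : seq nat) :=
  [&& strict p, gap2 p & size p == m].

Definition of_parity b (p : seq nat) := [seq x <- p | odd x == b].

(** One condition for both counts: [b = true] is that of C(n), [b = false] that of D(n). *)
Definition parity_condition b (p : seq nat) :=
  let o := of_parity b p in
  all (fun j => (nth 0 o j.-1 + 2 * j - 3 \notin p)
             && (nth 0 o j.-1 + 2 * j - 1 \notin p))%N (iota 1 (size o)).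

Lemma odd_parts_conditionE : odd_parts_condition =1 parity_condition true.
Proof.
move=> p; rewrite /odd_parts_condition /parity_condition /of_parity.
by rewrite -(eq_filter (fun x => esym (eqb_id (odd x)))).
Qed.

Lemma even_parts_conditionE : even_parts_condition =1 parity_condition false.
Proof.
move=> p; rewrite /even_parts_condition /parity_condition /of_parity.
by rewrite -(eq_filter (fun x => esym (eqbF_neg (odd x)))).
Qed.

(** Subtraction-free form with [i = j - 1]: the excluded values become the two neighbours of
    [nth 0 (of_parity b p) i + 2 * i]. *)
Lemma parity_conditionP b p : strict p ->
  reflect (forall i y, (i < size (of_parity b p))%N -> y \in p ->
     y.+1 != (nth 0 (of_parity b p) i + 2 * i)%N /\
     y != (nth 0 (of_parity b p) i + 2 * i).+1)
   (parity_condition b p).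
Proof.
move=> sp; rewrite /parity_condition; set o := of_parity b p.
have o_gt0 i : (i < size o)%N -> (0 < nth 0 o i)%N.
  move=> lti; apply: (strict_gt0 sp).
  by have := mem_nth 0%N lti; rewrite mem_filter => /andP[].
apply: (iffP allP) => [H i y lti yp | H j].
  have /andP[/memPn n1 /memPn n2] := H i.+1 ltac:(by rewrite mem_iota; lia).
  by have := o_gt0 i lti; have := n1 y yp; have := n2 y yp; rewrite /=; lia.
rewrite mem_iota; case: j => // i /= lti; have {}lti : (i < size o)%N by lia.
have o0 := o_gt0 i lti.
by apply/andP; split; apply/memPn => y yp; have := H i y lti yp; lia.
Qed.

Lemma path_ltn_le m n p : m <= n -> path ltn n p -> path ltn m p.
Proof. by case: p => //= x p lemn /andP[ltnx ->]; rewrite (leq_ltn_trans lemn). Qed.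

(** In the picture of tiles, [r] tiles of length 2 and [k] tiles of length 1. *)
Definition parity_size b r k p :=
  [&& strict p, parity_condition b p, size (of_parity b p) == r & size p == r + k].

Lemma of_parity_shift s p :
  of_parity (odd s) (map (addn s) p) = map (addn s) (of_parity false p).
Proof.
rewrite /of_parity filter_map; congr map; apply: eq_filter => x /=.
by rewrite oddD; case: (odd s); case: (odd x).
Qed.

(** Adding [s] everywhere moves parts and excluded values alike and changes the selected parity to
    that of [s]; [s = 1] links C(n) to D(n). *)
Lemma parity_condition_shift s p : strict p ->
  parity_condition (odd s) (map (addn s) p) = parity_condition false p.
Proof.
move=> sp; have ssp : strict (map (addn s) p).
  exact: path_ltn_le (leq0n s) (strict_shift s sp).
apply/(parity_conditionP _ ssp)/(parity_conditionP _ sp);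
  rewrite of_parity_shift size_map => H i y lti.
  move=> yp; have := H i (s + y) lti (map_f _ yp).
  by rewrite (nth_map 0%N) //; lia.
case/mapP=> x xp ->; have := H i x lti xp.
by rewrite (nth_map 0%N) //; lia.
Qed.

(* Prepending the smallest possible part [s] of parity [odd s] moves the even
   parts by [s], and the odd ones over the two values excluded by [s]. *)
Definition spread s x := s + x + 2 * odd x.

Definition insert_part s p := s :: sort leq (map (spread s) p).

Lemma odd_spread s x : odd (spread s x) = odd s (+) odd x.
Proof. by rewrite /spread mul2n !oddD odd_double addbF. Qed.

Lemma spread_inj s : injective (spread s).
Proof.
move=> x y E; have /(congr1 odd) := E; rewrite !odd_spread => /addbI Exy.
by move: E; rewrite /spread Exy; lia.
Qed.

Lemma sumn_spread s p : sumn (map (spread s) p)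
  = sumn p + s * size p + 2 * (size p - size (of_parity false p)).
Proof.
have le_of p' : size (of_parity false p') <= size p' by rewrite size_filter count_size.
elim: p => [|x p IH]; rewrite ?muln0 //= IH /spread; have := le_of p.
by case: (odd x) => /=; lia.
Qed.

Lemma mem_insert s p y :
  (y \in insert_part s p) = (y == s) || (y \in map (spread s) p).
Proof. by rewrite inE mem_sort. Qed.

Lemma spread_gt s p : strict p -> all (ltn s) (map (spread s) p).
Proof.
move=> sp; apply/allP => _ /mapP[x /(strict_gt0 sp) x_gt0 ->].
by rewrite /spread /=; lia.
Qed.

Lemma strict_insert s p : 0 < s -> strict p -> strict (insert_part s p).
Proof.
move=> s_gt0 sp; rewrite /strict /= s_gt0 path_sortedE; last exact: ltn_trans.
rewrite all_sort spread_gt //= ltn_sorted_uniq_leq sort_uniq.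
rewrite map_inj_uniq; last exact: spread_inj.
by move: sp; rewrite strictE => /andP[_ ->]; apply: (sort_sorted leq_total).
Qed.

Lemma of_parity_insert s p : strict p ->
  of_parity (odd s) (insert_part s p) = s :: map (addn s) (of_parity false p).
Proof.
move=> sp; rewrite /of_parity /= eqxx; congr (_ :: _).
rewrite (filter_sort leq_total leq_trans) filter_map.
have -> : [seq x <- p | preim (spread s) (fun x => odd x == odd s) x]
    = of_parity false p.
  by apply: eq_filter => x /=; rewrite odd_spread; case: (odd s); case: (odd x).
have -> : map (spread s) (of_parity false p) = map (addn s) (of_parity false p).
  apply/eq_in_map => x; rewrite mem_filter /spread => /andP[/eqP-> _]; lia.
apply: sorted_sort; first exact: leq_trans.
rewrite sorted_map (eq_sorted (e' := leq)); last by move=> x y /=; rewrite leq_add2l.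
apply: sorted_filter; first exact: leq_trans.
by have := strict_sorted sp; rewrite ltn_sorted_uniq_leq => /andP[].
Qed.

(** The new part raises the rank of each former even part by one, so the values it excludes move by
    [s + 2], exactly as far as [spread] moves the odd parts. The part [s] itself excludes [s - 1]
    and [s + 1], which no spread part attains. *)
Lemma parity_condition_insert s p : 0 < s -> strict p ->
  parity_condition (odd s) (insert_part s p) = parity_condition false p.
Proof.
move=> s_gt0 sp; have isp := strict_insert s_gt0 sp.
have nth_even i : i < size (of_parity false p) -> ~~ odd (nth 0 (of_parity false p) i).
  by move/(mem_nth 0); rewrite mem_filter => /andP[/eqP->].
apply/(parity_conditionP _ isp)/(parity_conditionP _ sp);
  rewrite of_parity_insert //= size_map => H i y lti.
  move=> yp; have ev := nth_even i lti.
  have := H i.+1 (spread s y) lti; rewrite mem_insert map_f ?orbT //= => /(_ isT).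
  rewrite (nth_map 0) // /spread; case: (boolP (odd y)) => /= oddy; lia.
rewrite mem_insert; case: i lti => [|i] /= lti.
  case/orP => [/eqP->|/mapP[x /(strict_gt0 sp) x_gt0 ->]]; first by lia.
  rewrite /spread; case: (boolP (odd x)) => /= oddx; lia.
rewrite (nth_map 0) //; case/orP => [/eqP->|/mapP[x xp ->]]; first by lia.
have := H i x lti xp; have := nth_even i lti.
rewrite /spread; case: (boolP (odd x)) => /= oddx; lia.
Qed.

Lemma insert_inj s : {in strict &, injective (insert_part s)}.
Proof.
move=> p1 p2 sp1 sp2 [] E; apply: sorted_ltn_eq; rewrite ?strict_sorted //.
apply/perm_mem/(perm_map_inj (@spread_inj s)).
by apply/(perm_sortP leq_total leq_trans anti_leq).
Qed.

(** 1 and 2 are the least positive integers of their parity. *)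
Lemma of_parity_min s p : 0 < s <= 2 -> strict p -> s \in p ->
  0 < size (of_parity (odd s) p) /\ nth 0 (of_parity (odd s) p) 0 = s.
Proof.
move=> s12 sp s_in.
have s_of : s \in of_parity (odd s) p by rewrite mem_filter eqxx.
have: sorted ltn (of_parity (odd s) p).
  by apply: sorted_filter; [exact: ltn_trans | exact: strict_sorted].
case Eo: (of_parity _ _) s_of => [|x o] //= s_of /(order_path_min ltn_trans)/allP o_gt.
split=> //; have: x \in of_parity (odd s) p by rewrite Eo mem_head.
rewrite mem_filter => /andP[/eqP oddx /(strict_gt0 sp) x_gt0].
move: s_of; rewrite inE => /predU1P[//|/o_gt /=]; lia.
Qed.

(** The exclusions make the inverse map well defined: without [s - 1], the part [s] is the least
    one; without [s + 1], the parts of the other parity are at least [s + 3] and remain positive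
    when lowered by [s + 2]. *)
Lemma insert_surj s p : 0 < s <= 2 -> strict p -> parity_condition (odd s) p ->
  s \in p -> exists2 p0, strict p0 & insert_part s p0 = p.
Proof.
move=> s12 sp cp s_in; have [o_gt0 o0] := of_parity_min s12 sp s_in.
have no y : y \in p -> y.+1 != s /\ y != s.+1.
  by move=> /((parity_conditionP _ sp) cp 0 y o_gt0); rewrite o0 addn0.
have p_ge y : y \in p -> s <= y.
  by move=> yp; have := no y yp; have := strict_gt0 sp yp; lia.
have [t Ep st] : exists2 t, p = s :: t & path ltn s t.
  case: p sp s_in p_ge {cp o_gt0 o0 no} => // x t /= /andP[x_gt0 xt] s_in p_ge.
  have /p_ge le_sx := mem_head x t; exists t; last first.
    exact: path_ltn_le le_sx xt.
  congr (_ :: _); move: s_in; rewrite inE => /predU1P[//|s_in].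
  by have /= := allP (order_path_min ltn_trans xt) s s_in; lia.
have t_gt := allP (order_path_min ltn_trans st).
pose unspread y := if odd y == odd s then y - s else y - s - 2.
have unspreadK : {in t, cancel unspread (spread s)}.
  move=> y yt; have := t_gt y yt; have := no y; rewrite Ep inE yt orbT => /(_ isT) /=.
  rewrite /unspread /spread; case: (odd y =P odd s) => oddy [_ y1] lt_sy.
    have -> : odd (y - s) = false by lia.
    by lia.
  have -> : odd (y - s - 2) = true by lia.
  by move=> /=; lia.
have unspread_gt0 y : y \in t -> 0 < unspread y.
  move=> yt; have := t_gt y yt; have := no y; rewrite Ep inE yt orbT => /(_ isT) /=.
  by rewrite /unspread; case: (odd y =P odd s); lia.
have t_sorted : uniq t && sorted leq t by rewrite -ltn_sorted_uniq_leq (path_sorted st).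
have [t_uniq t_leq] := andP t_sorted.
exists (sort leq (map unspread t)).
  rewrite strictE /positive_sorted (sort_sorted leq_total) mem_sort sort_uniq.
  rewrite map_inj_in_uniq ?t_uniq ?andbT; last exact: can_in_inj unspreadK.
  by apply/mapP => -[y /unspread_gt0 + y0]; rewrite -y0.
rewrite Ep; congr (_ :: _).
rewrite -[RHS](sorted_sort leq_trans t_leq).
apply/(perm_sortP leq_total leq_trans anti_leq).
apply: perm_trans (perm_map (spread s) (permEl (perm_sort _ _))) _.
by rewrite -map_comp map_id_in.
Qed.

Lemma all_ltnS s p : all (ltn s.+1) p = all (ltn s) p && (s.+1 \notin p).
Proof.
elim: p => //= x p ->; rewrite inE negb_or andbACA; congr (_ && _).
by rewrite /ltn /=; lia.
Qed.

Lemma strict_all_gt0 p : strict p -> all (ltn 0) p.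
Proof. exact: order_path_min ltn_trans. Qed.

(** * Recurrences in the numbers of parts of each parity *)

Section Recurrences.
Variables (R : comNzRingType) (N : nat) (q : R).
Hypothesis qN : (q ^+ N = 0)%R.
Local Notation gf := (gf N q).

Let N_gt0 := nilpotent_order_gt0 qN.

Lemma gf0 (P : pred (seq nat)) : (forall p, positive_sorted p -> P p = false) ->
  gf P = 0%R.
Proof.
move=> P0; rewrite (@eq_gf _ _ _ _ pred0) //; apply: big1 => n _.
by rewrite num_partitionsE count_pred0 mul0r.
Qed.

Lemma gf_parity_shift s r k :
  (gf (fun p => parity_size (odd s) r k p && all (ltn s) p)
  = q ^+ (s * (r + k)) * gf (parity_size false r k))%R.
Proof.
apply: (gf_shift qN (f := map (addn s))) => [p|p|p|p|p1 p2 _ _].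
- by case/and4P=> /strict_positive.
- by case/andP=> /and4P[/strict_positive].
- case/and4P=> sp cp sz1 sz2; have ssp := strict_shift s sp.
  rewrite /parity_size parity_condition_shift // cp of_parity_shift !size_map.
  rewrite sz1 sz2 sumn_shift (eqP sz2) (path_ltn_le (leq0n s) ssp : strict _).
  by rewrite (order_path_min ltn_trans ssp).
- case/andP=> /and4P[sp cp sz1 sz2 p_gt].
  have : path ltn s p by rewrite path_sortedE ?p_gt ?strict_sorted //; apply: ltn_trans.
  case/path_shift_inv => p0 sp0 Ep; exists p0 => //.
  move: cp sz1 sz2; rewrite -Ep parity_condition_shift // of_parity_shift !size_map.
  by rewrite /parity_size sp0 => -> -> ->.
- exact: (inj_map (@addnI s)).
Qed.

(** The exponent has [s] for the new part, [s] for each of the [r + k] former parts and 2 more for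
    each of the [k] odd ones. *)
Lemma gf_parity_insert s r k : 0 < s <= 2 ->
  (gf (fun p => parity_size (odd s) r.+1 k p && (s \in p))
  = q ^+ (s + s * (r + k) + 2 * k) * gf (parity_size false r k))%R.
Proof.
move=> s12; have s_gt0 : 0 < s by case/andP: s12.
apply: (gf_shift qN (f := insert_part s)) => [p|p|p|p|p1 p2].
- by case/and4P=> /strict_positive.
- by case/andP=> /and4P[/strict_positive].
- case/and4P=> sp cp /eqP sz1 /eqP sz2.
  rewrite /parity_size parity_condition_insert // cp of_parity_insert // strict_insert //.
  rewrite mem_head /= !size_sort !size_map sz1 sz2 !eqxx.
  rewrite (perm_sumn (permEl (perm_sort _ _))) sumn_spread sz1 sz2; split=> //; lia.
- case/andP=> /and4P[sp cp sz1 sz2 s_in].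
  have [p0 sp0 Ep] := insert_surj s12 sp cp s_in; exists p0 => //.
  move: cp sz1 sz2; rewrite -Ep parity_condition_insert // of_parity_insert //=.
  by rewrite size_sort !size_map /parity_size sp0 => -> /eqP[->] /eqP[->]; rewrite !eqxx.
- by case/and4P=> sp1 _ _ _ /and4P[sp2 _ _ _]; apply: insert_inj.
Qed.

(** After the shift by 2 the even parts are at least 4 and exclude only values from 3 on, so an
    additional part 1 is always allowed. *)
Lemma parity_condition_cons1 p : strict p ->
  parity_condition false (1 :: map (addn 2) p) = parity_condition false p.
Proof.
move=> sp; have s2p := strict_shift 2 sp.
have s1p : strict (1 :: map (addn 2) p) by rewrite /strict /= (path_ltn_le _ s2p).
have Eo : of_parity false (1 :: map (addn 2) p) = map (addn 2) (of_parity false p).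
  exact: (of_parity_shift 2).
have o_gt0 i : i < size (of_parity false p) -> 0 < nth 0 (of_parity false p) i.
  move=> /(mem_nth 0); rewrite mem_filter => /andP[_]; exact: strict_gt0.
rewrite -(parity_condition_shift 2 sp).
have ssp : strict (map (addn 2) p) by apply: path_ltn_le s2p.
apply/(parity_conditionP _ s1p)/(parity_conditionP _ ssp);
  rewrite ?Eo (of_parity_shift 2) => H i y lti yp.
  by apply: H; rewrite // inE yp orbT.
move: yp; rewrite inE => /predU1P[->|]; last exact: H.
by rewrite size_map in lti; rewrite (nth_map 0) //; have := o_gt0 i lti; lia.
Qed.

Lemma gf_parity_cons1 r k :
  (gf (fun p => [&& parity_size false r k.+1 p, 2 \notin p & 1 \in p])
  = q ^+ (1 + 2 * (r + k)) * gf (parity_size false r k))%R.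
Proof.
apply: (gf_shift qN (f := fun p => 1 :: map (addn 2) p)) => [p|p|p|p|p1 p2].
- by case/and4P=> /strict_positive.
- by case/andP=> /and4P[/strict_positive].
- case/and4P=> sp cp /eqP sz1 /eqP sz2; have s2p := strict_shift 2 sp.
  rewrite /parity_size parity_condition_cons1 // cp /= -/(of_parity _ _).
  rewrite (of_parity_shift 2) !size_map sz1 sz2 sumn_shift sz2.
  rewrite /strict /= (path_ltn_le _ s2p) // !eqxx addnS eqxx /=; split; last lia.
  by rewrite inE /= inE /= andbT; apply/memPn => y /(allP (order_path_min ltn_trans s2p)) /=; lia.
- case/and3P=> /and4P[sp cp sz1 sz2 p2 p1].
  have [t Ep st] : exists2 t, p = 1 :: t & path ltn 2 t.
    case: p sp p1 p2 {cp sz1 sz2} => // x t /= /andP[x_gt0 xt]; rewrite !inE.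
    have x_lt := allP (order_path_min ltn_trans xt).
    case/predU1P=> [Ex|/x_lt /=]; last by lia.
    move: xt; rewrite -Ex => xt.
    rewrite negb_or => /andP[_ t2]; exists t => //.
    rewrite path_sortedE ?(path_sorted xt) ?andbT; last exact: ltn_trans.
    by rewrite all_ltnS (order_path_min ltn_trans xt) t2.
  have [p0 sp0 Et] := path_shift_inv st; exists p0; last by rewrite Et.
  move: cp sz1 sz2; rewrite Ep -Et parity_condition_cons1 // /= -/(of_parity _ _).
  rewrite (of_parity_shift 2) !size_map addnS eqSS /parity_size sp0.
  by move=> -> -> ->.
- by move=> _ _ [] /(inj_map (@addnI 2)).
Qed.

Local Open Scope ring_scope.

Local Notation D r k := (gf (parity_size false r k)).

Lemma gf_parity00 : D 0 0 = 1.
Proof.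
by apply: gf_unit => // p _ _ /and4P[_ _ _ /nilP].
Qed.

(** Three exclusive cases: 2 is a part and is removed as an inserted tile; 2 is not a part but 1 is,
    and the 1 is removed; or all parts exceed 2 and are lowered by 2. *)
Lemma gf_even_rec r k : D r k =
  (if r is r'.+1 then q ^+ (2 + 2 * (r' + k) + 2 * k) * D r' k else 0) +
  (if k is k'.+1 then q ^+ (1 + 2 * (r + k')) * D r k' else 0) +
  q ^+ (2 * (r + k)) * D r k.
Proof.
rewrite [LHS](gf_split _ _ (fun p => 2%N \in p)) -addrA; congr (_ + _).
  case: r => [|r]; last exact: (@gf_parity_insert 2).
  apply: gf0 => p _; apply/negP => /andP[/and4P[sp _ /nilP sz0 _] p2].
  by have [] := of_parity_min (s := 2) isT sp p2; rewrite sz0.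
rewrite [LHS](gf_split _ _ (fun p => 1%N \in p)); congr (_ + _).
  case: k => [|k].
    apply: gf0 => p _; apply/negP => /andP[/andP[/and4P[sp _ /eqP sz /eqP sz'] _] p1].
    move: sz; rewrite addn0 in sz'; rewrite -sz' size_filter => /eqP.
    by rewrite -all_count => /allP /(_ _ p1).
  rewrite -gf_parity_cons1; apply: eq_gf => p _; by rewrite andbA.
rewrite -(gf_parity_shift 2); apply: eq_gf => p pp; rewrite -!andbA; apply: andb_id2l => sp.
rewrite !all_ltnS strict_all_gt0 //=; do !apply: andb_id2l => _.
exact: andbC.
Qed.

(** If 1 is not a part, lowering all parts by 1 exchanges the parities; if it is, it is removed as
    an inserted tile with [s = 1]. Both cases lead to the even condition. *)
Lemma gf_odd_rec r k : gf (parity_size true r k) =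
  q ^+ (r + k) * D r k + (if r is r'.+1 then q ^+ (1 + (r' + k) + 2 * k) * D r' k else 0).
Proof.
rewrite [LHS](gf_split _ _ (fun p => 1%N \in p)) addrC; congr (_ + _).
  rewrite -[(r + k)%N]mul1n -(gf_parity_shift 1); apply: eq_gf => p pp; apply: andb_id2l.
  by case/and4P=> sp _ _ _; rewrite all_ltnS strict_all_gt0.
case: r => [|r]; last first.
  by rewrite -{1}[(r + k)%N]mul1n; apply: (@gf_parity_insert 1).
apply: gf0 => p _; apply/negP => /andP[/and4P[sp _ /nilP sz0 _] p1].
by have [] := of_parity_min (s := 1) isT sp p1; rewrite sz0.
Qed.

End Recurrences.

(** * Evaluation of the generating functions *)

Local Open Scope ring_scope.

Section Evaluation.
Variables (R : comNzRingType).

Lemma sum_qbin_rev (q : R) m : \sum_(r < m.+1) qbin (q ^+ 2) m r * q ^+ (m - r) =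
  \sum_(r < m.+1) qbin (q ^+ 2) m r * q ^+ r.
Proof.
rewrite (reindex_inj rev_ord_inj); apply: eq_bigr => -[r /= ltr] _.
by rewrite subSS subKn // qbin_sym.
Qed.

(** In base $q^2$ the second half of the q-Pascal rule is $q^{m+1}$ times the same sum read
    backwards, whence the factor $1 + q^{m+1}$. *)
Lemma gauss_sum (q : R) m :
  \sum_(r < m.+1) qbin (q ^+ 2) m r * q ^+ r = \prod_(i < m) (1 + q ^+ i.+1).
Proof.
elim: m => [|m IH]; first by rewrite big_ord1 big_ord0 mulr1.
rewrite (sum_qbinSr _ _ (fun r => q ^+ r)) [RHS]big_ord_recr /= -IH mulrDr mulr1.
rewrite -{2}sum_qbin_rev big_distrl -big_split /=.
apply: eq_bigr => -[r /= ltr] _; rewrite mulrDr; congr (_ + _).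
have -> : q ^+ m.+1 = q ^+ (m - r) * q ^+ r.+1 by rewrite -exprD; congr (_ ^+ _); lia.
by rewrite exprAC; ring.
Qed.

Variables (N : nat) (q : R).
Hypothesis qN : q ^+ N = 0.
Local Notation w := (qpoch_inv N q).
Local Notation v := (qpoch_inv N (q ^+ 2)).

Lemma qpoch_invS (x : R) n : x ^+ N = 0 ->
  qpoch_inv N x n = qpoch_inv N x n.+1 * (1 - x ^+ n.+1).
Proof.
move=> xN; rewrite -[RHS]mul1r -{1}(qpoch_invK n xN) exprS.
transitivity (qpoch_inv N x n * (qpoch_inv N x n.+1 * qpoch x x n.+1)).
  by rewrite qpoch_invK // mulr1.
by rewrite qpochS; ring.
Qed.

(** Lets the recurrences that contain the unknown on both sides be solved for it. *)
Lemma one_sub_regular n (x y : R) :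
  x * (1 - q ^+ n.+1) = y * (1 - q ^+ n.+1) -> x = y.
Proof.
have K z : z = z * (1 - q ^+ n.+1) * (w n.+1 * qpoch q q n).
  by rewrite -[LHS]mulr1 -{1}(qpoch_invK n.+1 qN) qpochS -exprS; ring.
by move=> E; rewrite (K x) E -K.
Qed.

Lemma sqr_nilpotent : (q ^+ 2) ^+ N = 0.
Proof. by rewrite exprAC qN expr0n. Qed.

(** From $(q^2; q^2)_m = (q; q)_m (-q; q)_m$. *)
Lemma qpoch_inv_sqr m : v m * \prod_(i < m) (1 + q ^+ i.+1) = w m.
Proof.
have := qpoch_invK m sqr_nilpotent.
have -> : qpoch (q ^+ 2) (q ^+ 2) m = qpoch q q m * \prod_(i < m) (1 + q ^+ i.+1).
  rewrite /qpoch -big_split; apply: eq_bigr => i _ /=.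
  by rewrite -!exprS exprAC; ring.
move: (\prod_(i < m) _) => H vK.
transitivity (w m * (v m * (qpoch q q m * H))); last by rewrite vK mulr1.
by rewrite -[LHS]mul1r -(qpoch_invK m qN); ring.
Qed.

(** Induction on the number of parts. Multiplying by $1 - q^{2(m+1)}$ absorbs the last term of the
    recurrence and turns [v m.+1] into [v m]; the other two terms match the q-Pascal rule [qbinSr]
    in base $q^2$. *)
Lemma gf_evenE r k : gf N q (parity_size false r k) =
  q ^+ ((r + k) ^ 2 + r) * qbin (q ^+ 2) (r + k) r * v (r + k).
Proof.
move Em: (r + k)%N => m; elim: m r k Em => [|m IH] r k Em.
  have [-> ->] : r = 0%N /\ k = 0%N by lia.
  by rewrite gf_parity00 // /qpoch_inv big_ord0 !mulr1.
have vS : v m.+1 * (1 - q ^+ (2 * m).+2) = v m.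
  by rewrite (qpoch_invS m sqr_nilpotent) -exprM mulnS.
apply: (@one_sub_regular (2 * m).+1); rewrite -[RHS]mulrA vS mulrBr mulr1.
rewrite {1}gf_even_rec // Em mulnS [gf _ _ _ * _]mulrC addrK.
case: r k Em => [|r] [|k] Em; first by lia.
- rewrite add0r IH; last by lia.
  rewrite !qbin0 add0n addn0 (_ : k = m)%N; last by lia.
  rewrite !mulr1 mulrA -exprD; congr (_ ^+ _ * _); lia.
- rewrite addr0 IH; last by lia.
  rewrite (_ : r = m)%N ?qbinn; last by lia.
  rewrite !mulr1 mulrA -exprD; congr (_ ^+ _ * _); lia.
rewrite !IH; try lia.
rewrite qbinSr; last by lia.
rewrite mulrDr mulrDl !mulrA -!exprM -!exprD.
congr (_ ^+ _ * _ * _ + _ ^+ _ * _ * _); lia.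
Qed.

Lemma gf_even_size m :
  \sum_(r < m.+1) gf N q (parity_size false r (m - r)) = q ^+ (m ^ 2) * w m.
Proof.
rewrite -qpoch_inv_sqr -gauss_sum !big_distrr; apply: eq_bigr => -[r /= ltr] _.
by rewrite gf_evenE subnKC // exprD; ring.
Qed.

(** For [m.+1] parts, the partitions without 1 contribute $q^{m+1}$ times the even total and those
    with 1, by Gauss's identity read backwards, $q^{(m+1)^2}$ [w m]. These add up because [w m] is
    [w m.+1] times $1 - q^{m+1}$. *)
Lemma gf_odd_size m :
  \sum_(r < m.+1) gf N q (parity_size true r (m - r)) = q ^+ (m ^ 2) * w m.
Proof.
case: m => [|m].
  rewrite big_ord1 gf_odd_rec // gf_parity00 // /qpoch_inv big_ord0 addr0 !mulr1.
  by rewrite expr0.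
under eq_bigr do rewrite gf_odd_rec //.
rewrite big_split /= [X in _ + X]big_ord_recl /= add0r.
transitivity (q ^+ m.+1 * (q ^+ (m.+1 ^ 2) * w m.+1) + q ^+ (m.+1 ^ 2) * w m); last first.
  by rewrite (qpoch_invS m qN); ring.
congr (_ + _).
  rewrite -gf_even_size big_distrr; apply: eq_bigr => -[r /= ltr] _.
  by rewrite subnKC.
rewrite -qpoch_inv_sqr -gauss_sum -sum_qbin_rev !big_distrr.
apply: eq_bigr => -[r /= ltr] _; rewrite subSS gf_evenE subnKC //.
transitivity (q ^+ (m.+1 ^ 2 + (m - r)) * v m * qbin (q ^+ 2) m r).
  rewrite (_ : m.+1 ^ 2 + (m - r) = 1 + m + 2 * (m - r) + (m ^ 2 + r))%N; last by lia.
  by rewrite [in RHS]exprD; ring.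
by rewrite exprD; ring.
Qed.

(** * Partitions with gaps of at least 2 *)

Lemma gap2_shift s p : gap2 (map (addn s) p) = gap2 p.
Proof.
by rewrite /gap2 sorted_map; apply: eq_sorted => x y /=; rewrite -addnA leq_add2l.
Qed.

Lemma gap2_cons1 p : strict p -> gap2 (1%N :: map (addn 2%N) p) = gap2 p.
Proof.
rewrite -[RHS](gap2_shift 2%N); case: p => //= x p /andP[x_gt0 _].
have {}x_gt0 : (0 < x)%N := x_gt0.
by rewrite /gap2 /= (_ : 1 + 2 <= 2 + x)%N //; lia.
Qed.

(** If 1 is a part, remove it and lower the others by 2; otherwise lower all parts by 1. *)
Lemma gf_gap2_rec m : gf N q (gap2_size m.+1) =
  q ^+ (2 * m).+1 * gf N q (gap2_size m) + q ^+ m.+1 * gf N q (gap2_size m.+1).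
Proof.
rewrite [LHS](gf_split _ _ (fun p => 1%N \in p)); congr (_ + _).
  apply: (gf_shift qN (f := fun p => 1%N :: map (addn 2%N) p)) => [p|p|p|p|p1 p2].
  - by case/andP=> /strict_positive.
  - by case/andP=> /andP[/strict_positive].
  - case/and3P=> sp gp /eqP sz; rewrite /gap2_size gap2_cons1 // gp /= size_map sz.
    rewrite /strict /= (path_ltn_le _ (strict_shift 2 sp)) // eqxx mem_head.
    by rewrite sumn_shift sz; split=> //; lia.
  - case/andP=> /and3P[sp gp sz] p1.
    have [t Ep st] : exists2 t, p = 1%N :: t & path ltn 2 t.
      case: p sp p1 gp {sz} => // x t /andP[x_gt0 xt]; rewrite !inE => p1 xgt.
      have Ex : x = 1%N.
        case/predU1P: p1 => // /(allP (order_path_min ltn_trans xt)) /=; lia.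
      exists t; rewrite ?Ex //; move: xgt xt; rewrite /gap2 Ex /=.
      by case: (t) => //= y t' /andP[le3y _] /andP[_ yt']; apply/andP; split => //; lia.
    have [p0 sp0 Et] := path_shift_inv st; exists p0; last by rewrite Et.
    by move: gp sz; rewrite Ep -Et gap2_cons1 // /= size_map /gap2_size sp0 => -> /eqP[->] /=.
  - by move=> _ _ [] /(inj_map (@addnI 2)).
apply: (gf_shift qN (f := map (addn 1%N))) => [p|p|p|p|p1 p2 _ _].
- by case/andP=> /strict_positive.
- by case/andP=> /andP[/strict_positive].
- case/and3P=> sp gp /eqP sz; have ssp := strict_shift 1 sp.
  rewrite /gap2_size gap2_shift gp size_map sz (path_ltn_le (leq0n 1) ssp : strict _).
  rewrite sumn_shift sz eqxx mul1n; split=> //=.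
  by apply/memPn => y /(allP (order_path_min ltn_trans ssp)) /=; lia.
- case/andP=> /and3P[sp gp sz] p1.
  have : path ltn 1 p.
    rewrite path_sortedE ?strict_sorted ?andbT; [|done|exact: ltn_trans].
    by rewrite all_ltnS strict_all_gt0.
  case/path_shift_inv => p0 sp0 Ep; exists p0 => //.
  by move: gp sz; rewrite -Ep gap2_shift size_map /gap2_size sp0 => -> ->.
- exact: (inj_map (@addnI 1)).
Qed.

Lemma gf_gap2E m : gf N q (gap2_size m) = q ^+ (m ^ 2) * w m.
Proof.
elim: m => [|m IH].
  rewrite /qpoch_inv big_ord0 mulr1 expr0; apply: gf_unit => //.
    exact: nilpotent_order_gt0 qN.
  by move=> p _ _ /and3P[_ _ /nilP].
apply: (@one_sub_regular m); rewrite mulrBr mulr1 {1}gf_gap2_rec IH.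
rewrite [gf _ _ _ * _]mulrC addrK -mulrA -(qpoch_invS m qN) mulrA -exprD.
by congr (_ ^+ _ * _); lia.
Qed.

End Evaluation.

(** * Summation over the number of parts, and the product side *)

Section Totals.
Variables (R : comNzRingType) (N : nat) (q : R).
Hypothesis qN : q ^+ N = 0.
Local Notation gf := (gf N q).
Local Notation w := (qpoch_inv N q).

Let N_gt0 := nilpotent_order_gt0 qN.

Lemma size_le_sumn p : (0%N \notin p) -> (size p <= sumn p)%N.
Proof.
elim: p => //= x p IH; rewrite inE negb_or eq_sym -lt0n => /andP[x_gt0 /IH]; lia.
Qed.

Lemma gf_by_size (P : pred (seq nat)) :
  gf P = \sum_(m < N) gf (fun p => P p && (size p == m)).
Proof.
apply: gf_sum => p /andP[_ p0] ltN _; exact: leq_ltn_trans (size_le_sumn p0) ltN.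
Qed.

Lemma gf_gap2 : gf (fun p => uniq p && gap2 p) = \sum_(m < N) q ^+ (m ^ 2) * w m.
Proof.
rewrite gf_by_size; apply: eq_bigr => m _; rewrite -gf_gap2E //.
by apply: eq_gf => p pp; rewrite /gap2_size strictE pp /= andbA.
Qed.

Lemma gf_parity_condition b : gf (fun p => uniq p && parity_condition b p)
  = \sum_(m < N) q ^+ (m ^ 2) * w m.
Proof.
rewrite gf_by_size; apply: eq_bigr => m _.
transitivity (\sum_(r < m.+1) gf (parity_size b r (m - r))); last first.
  by case: b; rewrite (gf_odd_size, gf_even_size).
rewrite (@gf_sum _ _ _ (fun p => size (of_parity b p)) m.+1).
  apply: eq_bigr => -[r /= ltr] _; apply: eq_gf => p pp.
  by rewrite /parity_size strictE pp subnKC //= -!andbA; do 2!congr (_ && _); apply: andbC.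
move=> p _ _ /andP[_ /eqP <-]; rewrite ltnS size_filter; exact: count_size.
Qed.

(** The lower bound [k] allows the product for B(n) to be peeled off one factor at a time. *)
Definition parts_1_4_geq k (p : seq nat) :=
  [&& positive_sorted p, parts_1_4_mod_5 p & all (leq k) p].

Lemma all_leqS k p : all (leq k.+1) p = all (leq k) p && (k \notin p).
Proof.
elim: p => //= x p ->; rewrite inE negb_or [RHS]andbACA; congr (_ && _).
by rewrite [RHS]andbC -ltn_neqAle.
Qed.

Lemma gf_parts_skip k : ~~ ((k == 1 %[mod 5]) || (k == 4 %[mod 5])) ->
  gf (parts_1_4_geq k) = gf (parts_1_4_geq k.+1).
Proof.
move=> kmod; apply: eq_gf => p _; rewrite /parts_1_4_geq all_leqS.
apply: andb_id2l => _; apply: andb_id2l => pm.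
rewrite (_ : k \notin p) ?andbT //; apply: contra kmod; exact: (allP pm).
Qed.

(** Removing one copy of [k] maps the partitions that contain [k] onto all those with parts at least
    [k]. *)
Lemma gf_parts_keep k : (0 < k)%N -> (k == 1 %[mod 5]) || (k == 4 %[mod 5]) ->
  gf (parts_1_4_geq k) * (1 - q ^+ k) = gf (parts_1_4_geq k.+1).
Proof.
move=> k_gt0 kmod; rewrite mulrBr mulr1 {1}(gf_split _ _ (fun p => k \in p)).
have -> : gf (fun p => parts_1_4_geq k p && (k \in p)) = q ^+ k * gf (parts_1_4_geq k).
  apply: (gf_shift qN (f := cons k)) => [p|p|p|p|p1 p2 _ _ []//].
  - by case/andP.
  - by case/andP=> /andP[].
  - case/and3P=> /andP[sp p0] pm pk; rewrite mem_head /= addnC andbT; split=> //.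
    rewrite /parts_1_4_geq /positive_sorted /= (path_min_sorted pk) sp inE negb_or p0.
    by rewrite kmod leqnn pk pm andbT eq_sym -lt0n k_gt0.
  - case/andP=> /and3P[/andP[sp p0] pm pk] kp.
    case: p sp p0 pm pk kp => // x t /= xt; rewrite inE negb_or => /andP[_ t0] /andP[_ tm].
    case/andP=> lekx tk; rewrite inE => kxt.
    have Ex : x = k.
      apply/eqP; rewrite eqn_leq lekx andbT.
      case/predU1P: kxt => [->//|]; exact: (allP (order_path_min leq_trans xt)).
    exists t; rewrite ?Ex //.
    by rewrite /parts_1_4_geq /positive_sorted (path_sorted xt) t0 tm tk.
rewrite mulrC addrAC subrr add0r; apply: eq_gf => p _.
by rewrite /parts_1_4_geq all_leqS -!andbA.
Qed.

Lemma gf_parts_step i :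
  gf (parts_1_4_geq (5 * i).+1) * (1 - q ^+ (5 * i).+1) * (1 - q ^+ (5 * i).+4)
  = gf (parts_1_4_geq (5 * i.+1).+1).
Proof.
have -> : ((5 * i.+1).+1 = (5 * i).+4.+2)%N by lia.
rewrite gf_parts_keep //; last by lia.
rewrite (@gf_parts_skip (5 * i).+2); last by lia.
rewrite (@gf_parts_skip (5 * i).+3); last by lia.
rewrite gf_parts_keep //; last by lia.
by rewrite (@gf_parts_skip (5 * i).+4.+1); last by lia.
Qed.

Lemma gf_parts_1_4 n : gf parts_1_4_mod_5
    * (qpoch (q ^+ 5) q n * qpoch (q ^+ 5) (q ^+ 4) n)
  = gf (parts_1_4_geq (5 * n).+1).
Proof.
elim: n => [|n IH].
  rewrite /qpoch !big_ord0 !mulr1; apply: eq_gf => p pp.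
  rewrite /parts_1_4_geq pp muln0 (_ : all (leq 1) p) ?andbT //.
  by case/andP: pp => _ p0; apply/allP => -[|x] // x0; rewrite x0 in p0.
rewrite -gf_parts_step -IH !qpochS -exprM -!exprS -exprD; ring.
Qed.

(** After [N + N] blocks of five only the empty partition is left in degree below [N]. The series
    for B(n) and the sum thus have the same product as inverse. *)
Lemma gf_parts_1_4E : gf parts_1_4_mod_5 = \sum_(m < N) q ^+ (m ^ 2) * w m.
Proof.
have RR := rogers_ramanujan qN; have := gf_parts_1_4 (N + N).
rewrite [RHS]gf_unit //; last first.
  by move=> [|x p] // _ /= ltN /and3P[_ _ /= /andP[lex _]]; lia.
move: RR; move: (qpoch _ _ _ * _) => z Sz Bz.
by rewrite -[LHS]mulr1 -Sz mulrCA Bz mulr1.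
Qed.

End Totals.

(** The hypothesis is used in [int[X] / X^(n+1)], with the class of [X] as [q]. *)
Lemma num_partitions_eq n (P Q : pred (seq nat)) :
  (forall (R : comNzRingType) (q : R), q ^+ n.+1 = 0 -> gf n.+1 q P = gf n.+1 q Q) ->
  num_partitions n P = num_partitions n Q.
Proof.
pose Xn : {poly int} := 'X^(n.+1).
have coef_gf S : (val (gf n.+1 ('qX : {poly %/ Xn}) S))`_n = (num_partitions n S)%:R.
  have -> : gf n.+1 ('qX : {poly %/ Xn}) S
      = in_qpoly Xn (\poly_(i < n.+1) (num_partitions i S)%:R).
    rewrite poly_def rmorph_sum; apply: eq_bigr => i _.
    rewrite scaler_nat raddfMn mulr_natl /=; congr (_ *+ _).
    by rewrite -[LHS](rmorphXn (in_qpoly Xn)).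
  (* The truncated series has degree at most [n], so reduction modulo $X^{n+1}$ leaves its
     coefficients intact. *)
  set g := \poly_(i < _) _; have sz_g : (size g < size (mk_monic Xn))%N.
    by rewrite /Xn mk_monic_Xn size_polyXn ltnS size_poly.
  by rewrite [val _](in_qpoly_small sz_g) coef_poly ltnSn.
move=> /(_ _ ('qX : {poly %/ Xn})) E; apply/eqP; rewrite -(Num.Theory.eqr_nat int) -!coef_gf E //.
apply: val_inj; rewrite -rmorphXn /=.
by rewrite /Xn mk_monic_Xn Pdiv.RingMonic.rmodpp // monicXn.
Qed.

Local Open Scope nat_scope.

Theorem theorem6 (n : nat) (n_gt0 : 0 < n) :
  A n = B n /\ B n = C n /\ C n = D n.
Proof.
have CE : C n = num_partitions n (fun p => uniq p && parity_condition true p).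
  rewrite /C !num_partitionsE; apply: eq_count => p; by rewrite odd_parts_conditionE.
have DE : D n = num_partitions n (fun p => uniq p && parity_condition false p).
  rewrite /D !num_partitionsE; apply: eq_count => p; by rewrite even_parts_conditionE.
rewrite CE DE; split; last split; apply: num_partitions_eq => R q qN.
- by rewrite gf_gap2 // gf_parts_1_4E.
- by rewrite gf_parts_1_4E // gf_parity_condition.
- by rewrite !gf_parity_condition.
Qed.
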